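(* Let $\mathcal{R}$ be a commutative ring with unity and let $\mathcal{A}$ be an $\mathcal{R}$-algebra with a generalized triangular matrix representation \[ \mathcal{A}=\begin{pmatrix} \mathcal{A}_{11} & \mathcal{A}_{12} & \cdots & \mathcal{A}_{1n}\\ 0 & \mathcal{A}_{22} & \cdots & \mathcal{A}_{2n}\\ \vdots & \vdots & \ddots & \vdots\\ 0 & 0 & \cdots & \mathcal{A}_{nn}\end{pmatrix}, \] where each $\mathcal{A}_{ii}$ is an algebra with unity and $\mathcal{A}_{ij}$ is an $(\mathcal{A}_{ii},\mathcal{A}_{jj})$-bimodule for $i<j$. If, for all $1\leq i\leq n$ and $1\leq k\leq i$, any local left multiplier from $\mathcal{A}_{ii}$ into $\mathcal{A}_{ki}$ is a left multiplier, then $\mathcal{A}$ is a SLIP algebra.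
   Context: All algebras are associative $\mathcal{R}$-algebras with unity $1$ and all modules and bimodules are unital; modules over an $\mathcal{R}$-algebra are $\mathcal{R}$-modules in the compatible way (for bimodules, $rm=mr$ for $r\in\mathcal{R}$). An algebra has a generalized triangular matrix representation if it is isomorphic, as an $\mathcal{R}$-algebra, to an algebra of upper triangular $n\times n$ matrices with $(i,j)$-entries in $\mathcal{A}_{ij}$ ($i\le j$) and zeros below the diagonal, under the usual matrix operations, where each $\mathcal{A}_{ii}$ is an algebra with unity and each $\mathcal{A}_{ij}$ ($i<j$) is an $(\mathcal{A}_{ii},\mathcal{A}_{jj})$-bimodule (the products $\mathcal{A}_{ij}\times\mathcal{A}_{jk}\to\mathcal{A}_{ik}$ used in matrix multiplication being those making the matrices an associative algebra and extending the bimodule actions). For an algebra $\mathcal{C}$ and a right $\mathcal{C}$-module $\mathcal{X}$, an $\mathcal{R}$-linear map $\psi:\mathcal{C}\to\mathcal{X}$ is a left multiplier if $\psi(c)=\psi(1)c$ for all $c\in\mathcal{C}$; it is a local left multiplier if for each $c\in\mathcal{C}$ there exists $x_c\in\mathcal{X}$ with $\psi(c)=x_c c$. An $\mathcal{R}$-linear map $\psi:\mathcal{C}\to\mathcal{C}$ is LIP (left-ideal-preserving) if $\psi(\mathcal{J})\subseteq\mathcal{J}$ for every left ideal $\mathcal{J}$ of $\mathcal{C}$ (equivalently, $\psi$ is a local left multiplier from $\mathcal{C}$ to $\mathcal{C}$). The algebra $\mathcal{C}$ is SLIP if every LIP map on $\mathcal{C}$ is a left multiplier. *)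

(* Defs.v *)
From HB Require Import structures.
From mathcomp Require Import all_boot all_order all_algebra.

Set Implicit Arguments.
Unset Strict Implicit.
Unset Printing Implicit Defensive.

Import GRing.Theory.
Local Open Scope ring_scope.

(* MathComp's algType only contains nonzero rings, whereas a diagonal block of a
   triangular matrix algebra may be the zero algebra.  The axioms below are those
   of algType over a possibly zero pzRingType. *)
Record unital_algebra (R : pzRingType) := UnitalAlgebra {
  ualg_ring : pzRingType;
  ualg_scale : R -> ualg_ring -> ualg_ring;
  ualg_scaleA : forall r s a,
    ualg_scale r (ualg_scale s a) = ualg_scale (r * s) a;
  ualg_scale1 : left_id 1 ualg_scale;
  ualg_scaleDr : right_distributive ualg_scale +%R;
  ualg_scaleDl : forall a, {morph ualg_scale^~ a : r s / r + s};
  ualg_scaleAl : forall r a b, ualg_scale r (a * b) = ualg_scale r a * b;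
  ualg_scaleAr : forall r a b, ualg_scale r (a * b) = a * ualg_scale r b
}.

Definition ualg_sort (R : pzRingType) (A : unital_algebra R) : Type :=
  ualg_ring A.
Coercion ualg_sort : unital_algebra >-> Sortclass.

HB.instance Definition _ (R : pzRingType) (A : unital_algebra R) :=
  GRing.PzRing.on (ualg_sort A).
HB.instance Definition _ (R : pzRingType) (A : unital_algebra R) :=
  GRing.Zmodule_isLmodule.Build R (ualg_sort A)
    (@ualg_scaleA R A) (@ualg_scale1 R A)
    (@ualg_scaleDr R A) (@ualg_scaleDl R A).

Lemma ualg_scalerAl (R : pzRingType) (A : unital_algebra R) (r : R) (a b : A) :
  r *: (a * b) = (r *: a) * b.
Proof. exact: ualg_scaleAl. Qed.

Lemma ualg_scalerAr (R : pzRingType) (A : unital_algebra R) (r : R) (a b : A) :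
  r *: (a * b) = a * (r *: b).
Proof. exact: ualg_scaleAr. Qed.

Definition ualg_of_algType (R : pzRingType) (A : algType R) : unital_algebra R :=
  @UnitalAlgebra R A *:%R (@scalerA R A) (@scale1r R A) (@scalerDr R A)
    (fun a r s => scalerDl a r s)
    (fun r a b => scalerAl r a b) (fun r a b => scalerAr r a b).

Definition alg_isomorphic (R : pzRingType) (A B : unital_algebra R) : Prop :=
  exists phi : A -> B, [/\ linear phi, monoid_morphism phi & bijective phi].

(* The library has no right modules carrying a compatible R-module structure:
   a lmodType C^c would have its own scalar action, unrelated to that of R. *)
Record right_module (R : pzRingType) (C : unital_algebra R) := RightModule {
  rmod_sort :> lmodType R;
  ract : rmod_sort -> C -> rmod_sort;
  ractDl : forall x y c, ract (x + y) c = ract x c + ract y c;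
  ractDr : forall x c d, ract x (c + d) = ract x c + ract x d;
  ractA : forall x c d, ract x (c * d) = ract (ract x c) d;
  ract1 : forall x, ract x 1 = x;
  ractZl : forall r x c, ract (r *: x) c = r *: ract x c;
  ractZr : forall r x c, ract x (r *: c) = r *: ract x c
}.

Definition regular_rmod (R : pzRingType) (C : unital_algebra R) : right_module C :=
  @RightModule R C (ualg_sort C : lmodType R) (fun x c => x * c)
    (fun x y c => mulrDl x y c) (fun x c d => mulrDr x c d)
    (fun x c d => mulrA x c d) (@mulr1 C)
    (fun r x c => esym (ualg_scalerAl r x c))
    (fun r x c => esym (ualg_scalerAr r x c)).

Section Multipliers.
Variables (R : pzRingType) (C : unital_algebra R).

Definition left_multiplier (X : right_module C) (psi : {linear C -> X}) : Prop :=
  forall c : C, psi c = ract (psi 1) c.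

Definition local_left_multiplier (X : right_module C) (psi : {linear C -> X}) :
    Prop :=
  forall c : C, exists x : X, psi c = ract x c.

(* Closure under opposites and under scaling by R follows, since C is unital. *)
Definition left_ideal (J : C -> Prop) : Prop :=
  [/\ J 0, forall x y, J x -> J y -> J (x + y)
    & forall a x, J x -> J (a * x)].

Definition LIP (psi : {linear C -> C}) : Prop :=
  forall J : C -> Prop, left_ideal J -> forall x, J x -> J (psi x).

Definition SLIP : Prop :=
  forall psi : {linear C -> C}, LIP psi -> left_multiplier (X := regular_rmod C) psi.

End Multipliers.

(* The entries A_ij of a generalized triangular matrix algebra.  The family is
   indexed by all pairs (i, j), with the zero module below the diagonal, so that
   no comparison proof occurs in the products A_ij x A_jk -> A_ik; a product with
   a factor below the diagonal is 0 and the axioms constrain only i <= j <= k <= l.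
   Those products contain all the structure: A_ii x A_ii -> A_ii is the product
   of the algebra A_ii, and A_ii x A_ij -> A_ij and A_ij x A_jj -> A_ij are the
   two actions of the unital bimodule A_ij (with r m = m r). *)
Record tri_system (R : pzRingType) (n : nat) := TriSystem {
  ent : 'I_n -> 'I_n -> lmodType R;
  emul : forall i j k, ent i j -> ent j k -> ent i k;
  eone : forall i, ent i i;
  ent_lower : forall i j : 'I_n, (j < i)%N -> forall x : ent i j, x = 0;
  emulDl : forall i j k (x y : ent i j) (z : ent j k),
    emul (x + y) z = emul x z + emul y z;
  emulDr : forall i j k (x : ent i j) (y z : ent j k),
    emul x (y + z) = emul x y + emul x z;
  emulZl : forall i j k r (x : ent i j) (y : ent j k),
    emul (r *: x) y = r *: emul x y;
  emulZr : forall i j k r (x : ent i j) (y : ent j k),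
    emul x (r *: y) = r *: emul x y;
  emulA : forall i j k l (x : ent i j) (y : ent j k) (z : ent k l),
    emul x (emul y z) = emul (emul x y) z;
  emul1l : forall i j (x : ent i j), emul (eone i) x = x;
  emul1r : forall i j (x : ent i j), emul x (eone j) = x
}.

Section TriSystemTheory.
Variables (R : pzRingType) (n : nat) (T : tri_system R n).

Lemma emul0l i j k (y : ent T j k) : emul (0 : ent T i j) y = 0.
Proof. by apply: (addrI (emul 0 y)); rewrite -emulDl !addr0. Qed.

Lemma emul0r i j k (x : ent T i j) : emul x (0 : ent T j k) = 0.
Proof. by apply: (addrI (emul x 0)); rewrite -emulDr !addr0. Qed.

Lemma emul_suml i j k (I : finType) (F : I -> ent T i j) (y : ent T j k) :
  emul (\sum_s F s) y = \sum_s emul (F s) y.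
Proof.
by apply: (big_morph (fun x => emul x y)) => [u v|]; rewrite ?emulDl ?emul0l.
Qed.

Lemma emul_sumr i j k (I : finType) (x : ent T i j) (F : I -> ent T j k) :
  emul x (\sum_s F s) = \sum_s emul x (F s).
Proof.
by apply: (big_morph (fun y => emul x y)) => [u v|]; rewrite ?emulDr ?emul0r.
Qed.

Definition diag_ring (i : 'I_n) : Type := ent T i i.

HB.instance Definition _ (i : 'I_n) := GRing.Lmodule.on (diag_ring i).
HB.instance Definition _ (i : 'I_n) :=
  GRing.Zmodule_isPzRing.Build (diag_ring i)
    (fun x y z => @emulA R n T i i i i x y z)
    (@emul1l R n T i i) (@emul1r R n T i i)
    (fun x y z => @emulDl R n T i i i x y z)
    (fun x y z => @emulDr R n T i i i x y z).

(* The algebra A_ii. *)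
Definition diag (i : 'I_n) : unital_algebra R :=
  @UnitalAlgebra R (diag_ring i) *:%R
    (@scalerA R (ent T i i)) (@scale1r R (ent T i i))
    (@scalerDr R (ent T i i)) (fun a r s => @scalerDl R (ent T i i) a r s)
    (fun r x y => esym (@emulZl R n T i i i r x y))
    (fun r x y => esym (@emulZr R n T i i i r x y)).

(* A_ki as a right A_ii-module. *)
Definition entry_rmod (k i : 'I_n) : right_module (diag i) :=
  @RightModule R (diag i) (ent T k i) (fun x c => emul x (c : ent T i i))
    (fun x y c => emulDl x y (c : ent T i i))
    (fun x c d => @emulDr R n T k i i x c d)
    (fun x c d => @emulA R n T k i i i x c d)
    (@emul1r R n T k i)
    (fun r x c => @emulZl R n T k i i r x c)
    (fun r x c => @emulZr R n T k i i r x c).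

Definition gtmx_sort : Type := {dffun forall p : 'I_n * 'I_n, ent T p.1 p.2}.

HB.instance Definition _ := Choice.on gtmx_sort.

Definition gtmx_entry (a : gtmx_sort) (i j : 'I_n) : ent T i j := a (i, j).

Definition gtmx_of (f : forall i j, ent T i j) : gtmx_sort := [ffun p => f p.1 p.2].

Lemma gtmx_ofE f i j : gtmx_entry (gtmx_of f) i j = f i j.
Proof. by rewrite /gtmx_entry ffunE. Qed.

Lemma gtmxP (a b : gtmx_sort) :
  (forall i j, gtmx_entry a i j = gtmx_entry b i j) -> a = b.
Proof. by move=> ab; apply/ffunP => -[i j]; exact: ab. Qed.

Definition gtmx_add (a b : gtmx_sort) :=
  gtmx_of (fun i j => gtmx_entry a i j + gtmx_entry b i j).
Definition gtmx_opp (a : gtmx_sort) := gtmx_of (fun i j => - gtmx_entry a i j).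
Definition gtmx_scale (r : R) (a : gtmx_sort) :=
  gtmx_of (fun i j => r *: gtmx_entry a i j).
Definition gtmx_mul (a b : gtmx_sort) :=
  gtmx_of (fun i k => \sum_j emul (gtmx_entry a i j) (gtmx_entry b j k)).
Definition gtmx_one_entry (i j : 'I_n) : ent T i j :=
  if i =P j is ReflectT e then ecast j (ent T i j) e (eone T i) else 0.
Definition gtmx_one := gtmx_of gtmx_one_entry.

Lemma gtmx_one_diag i : gtmx_one_entry i i = eone T i.
Proof. by rewrite /gtmx_one_entry; case: eqP => // e; rewrite eq_axiomK. Qed.

Lemma gtmx_one_off i j : i != j -> gtmx_one_entry i j = 0.
Proof. by rewrite /gtmx_one_entry; case: eqP. Qed.

Lemma gtmx_addA : associative gtmx_add.
Proof. by move=> a b c; apply: gtmxP => i j; rewrite !gtmx_ofE addrA. Qed.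
Lemma gtmx_addC : commutative gtmx_add.
Proof. by move=> a b; apply: gtmxP => i j; rewrite !gtmx_ofE addrC. Qed.
Lemma gtmx_add0 : left_id (gtmx_of (fun i j => 0)) gtmx_add.
Proof. by move=> a; apply: gtmxP => i j; rewrite !gtmx_ofE add0r. Qed.
Lemma gtmx_addN : left_inverse (gtmx_of (fun i j => 0)) gtmx_opp gtmx_add.
Proof. by move=> a; apply: gtmxP => i j; rewrite !gtmx_ofE addNr. Qed.

HB.instance Definition _ :=
  GRing.isZmodule.Build gtmx_sort gtmx_addA gtmx_addC gtmx_add0 gtmx_addN.

Lemma gtmx_scaleA r s a : gtmx_scale r (gtmx_scale s a) = gtmx_scale (r * s) a.
Proof. by apply: gtmxP => i j; rewrite !gtmx_ofE scalerA. Qed.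
Lemma gtmx_scale1 : left_id 1 gtmx_scale.
Proof. by move=> a; apply: gtmxP => i j; rewrite !gtmx_ofE scale1r. Qed.
Lemma gtmx_scaleDr : right_distributive gtmx_scale +%R.
Proof. by move=> r a b; apply: gtmxP => i j; rewrite !gtmx_ofE scalerDr. Qed.
Lemma gtmx_scaleDl a : {morph gtmx_scale^~ a : r s / r + s}.
Proof. by move=> r s; apply: gtmxP => i j; rewrite !gtmx_ofE scalerDl. Qed.

HB.instance Definition _ :=
  GRing.Zmodule_isLmodule.Build R gtmx_sort
    gtmx_scaleA gtmx_scale1 gtmx_scaleDr gtmx_scaleDl.

Lemma gtmx_mulA : associative gtmx_mul.
Proof.
move=> a b c; apply: gtmxP => i l; rewrite !gtmx_ofE.
under eq_bigr => j _ do rewrite gtmx_ofE emul_sumr.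
under [RHS]eq_bigr => k _ do rewrite gtmx_ofE emul_suml.
rewrite exchange_big; apply: eq_bigr => k _; apply: eq_bigr => j _.
exact: emulA.
Qed.

Lemma gtmx_mul1l : left_id gtmx_one gtmx_mul.
Proof.
move=> a; apply: gtmxP => i k; rewrite gtmx_ofE (bigD1 i) //= big1 => [|j ji].
  by rewrite gtmx_ofE gtmx_one_diag emul1l addr0.
by rewrite gtmx_ofE gtmx_one_off ?emul0l // eq_sym.
Qed.

Lemma gtmx_mul1r : right_id gtmx_one gtmx_mul.
Proof.
move=> a; apply: gtmxP => i k; rewrite gtmx_ofE (bigD1 k) //= big1 => [|j jk].
  by rewrite gtmx_ofE gtmx_one_diag emul1r addr0.
by rewrite gtmx_ofE gtmx_one_off ?emul0r.
Qed.

Lemma gtmx_mulDl : left_distributive gtmx_mul +%R.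
Proof.
move=> a b c; apply: gtmxP => i k; rewrite !gtmx_ofE -big_split.
by apply: eq_bigr => j _; rewrite gtmx_ofE emulDl.
Qed.

Lemma gtmx_mulDr : right_distributive gtmx_mul +%R.
Proof.
move=> a b c; apply: gtmxP => i k; rewrite !gtmx_ofE -big_split.
by apply: eq_bigr => j _; rewrite gtmx_ofE emulDr.
Qed.

HB.instance Definition _ :=
  GRing.Zmodule_isPzRing.Build gtmx_sort
    gtmx_mulA gtmx_mul1l gtmx_mul1r gtmx_mulDl gtmx_mulDr.

Lemma gtmx_scaleAl r (a b : gtmx_sort) : r *: (a * b) = (r *: a) * b.
Proof.
apply: gtmxP => i k; rewrite !gtmx_ofE scaler_sumr.
by apply: eq_bigr => j _; rewrite gtmx_ofE emulZl.
Qed.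

Lemma gtmx_scaleAr r (a b : gtmx_sort) : r *: (a * b) = a * (r *: b).
Proof.
apply: gtmxP => i k; rewrite !gtmx_ofE scaler_sumr.
by apply: eq_bigr => j _; rewrite gtmx_ofE emulZr.
Qed.

Definition gtmx : unital_algebra R :=
  @UnitalAlgebra R gtmx_sort *:%R gtmx_scaleA gtmx_scale1
    gtmx_scaleDr gtmx_scaleDl gtmx_scaleAl gtmx_scaleAr.

End TriSystemTheory.

(* Main.v *)
Require Import Defs.
From HB Require Import structures.
From mathcomp Require Import all_boot all_order all_algebra.

Set Implicit Arguments.
Unset Strict Implicit.
Unset Printing Implicit Defensive.

Local Open Scope ring_scope.

(** An LIP map [psi] is pointwise a left multiplication, with a factor that may
    vary with the point.  For an idempotent [e] this already pins the map down:
    [psi e] lies in the left ideal of [e] and [psi (1 - e)] in that of [1 - e],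
    so multiplying [psi 1 = psi e + psi (1 - e)] by [e] on the right leaves
    [psi e = psi 1 * e] ([local_mul_idempotent]).

    Let [E_ij m] be the matrix with the single entry [m] at position [(i, j)].
    For [i != j], [E_ii 1 + E_ij m] is an idempotent, as is [E_ii 1], hence
    their difference [E_ij m] is mapped to [psi 1 * E_ij m]
    ([local_offdiag]).  On the diagonal, the [(k, i)] entry of
    [psi (E_ii c)] is a local left multiplier of [c], from [A_ii] to [A_ki], and
    the hypothesis on the blocks applies ([local_diag]).  Since the [E_ij m] span
    the matrix algebra, [psi] is a left multiplier; the property of being SLIP is
    then carried along the isomorphism ([SLIP_iso]). *)

Import GRing.Theory.

(** With [f := 1 - e], [psi e] is in the left ideal of [e] and [psi f] in that of
    [f], so right multiplication by [e] fixes the former and kills the latter. *)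
Lemma local_mul_idempotent (C : pzRingType) (psi : {additive C -> C}) (e : C) :
  (forall c, exists x, psi c = x * c) -> e * e = e -> psi e = psi 1 * e.
Proof.
move=> psi_loc ee; have [x psi_e] := psi_loc e.
have [y psi_f] := psi_loc (1 - e).
have -> : psi 1 = psi e + psi (1 - e) by rewrite -raddfD addrC subrK.
by rewrite mulrDl psi_e psi_f -!mulrA mulrBl mul1r ee subrr mulr0 addr0.
Qed.

(** The principal left ideal of [c] is the smallest one containing [c], so testing
    [psi] on principal ideals suffices. *)
Lemma LIP_local (R : pzRingType) (C : unital_algebra R) (psi : {linear C -> C}) :
  LIP psi <-> forall c : C, exists x, psi c = x * c.
Proof.
split=> [psiP c | psiP J [_ _ JM] c Jc]; last by have [x ->] := psiP c; apply: JM.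
apply: (psiP (fun y => exists x, y = x * c)); last by exists 1; rewrite mul1r.
split=> [|_ _ [x ->] [y ->]|a _ [x ->]].
- by exists 0; rewrite mul0r.
- by exists (x + y); rewrite mulrDl.
- by exists (a * x); rewrite mulrA.
Qed.

(** Conjugating an LIP map by the isomorphism gives an LIP map: the pointwise
    factors [x] are simply carried to [phi x]. *)
Lemma SLIP_iso (R : pzRingType) (A B : unital_algebra R) :
  alg_isomorphic A B -> SLIP B -> SLIP A.
Proof.
move=> [phi [phiL [phi1 phiM] [g phiK gK]]] slipB psi /LIP_local psi_loc.
have phi_inj := can_inj phiK.
have gL : linear g by move=> r x y; apply: phi_inj; rewrite phiL !gK.
have tauL : linear (fun b => phi (psi (g b))) by move=> r x y; rewrite gL linearP phiL.
pose tau : {linear B -> B} :=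
  HB.pack (fun b => phi (psi (g b))) (GRing.isLinear.Build R B B _ _ tauL).
have /slipB tau_mul : LIP tau.
  apply/LIP_local => b; have [x psi_gb] := psi_loc (g b).
  by exists (phi x); rewrite /tau /= psi_gb phiM gK.
move=> a; apply: phi_inj; rewrite phiM.
have /= := tau_mul (phi a); rewrite /tau /= phiK => ->.
by rewrite -phi1 phiK.
Qed.

Section MatrixUnits.
Variables (R : pzRingType) (n : nat) (T : tri_system R n).
Implicit Types (i j k l : 'I_n) (a b : gtmx T).

Definition gtmx_delta i j (m : ent T i j) : gtmx T :=
  [ffun p => dfwith (T := fun q => ent T q.1 q.2) (fun=> 0) (i := (i, j)) m p].

Lemma gtmx_deltaE i j (m : ent T i j) : gtmx_entry (gtmx_delta m) i j = m.
Proof.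
by rewrite /gtmx_entry ffunE (dfwith_in (T := fun q => ent T q.1 q.2)).
Qed.

Lemma gtmx_delta_off i j k l (m : ent T i j) :
  (i, j) != (k, l) -> gtmx_entry (gtmx_delta m) k l = 0.
Proof.
by move=> neq; rewrite /gtmx_entry ffunE (dfwith_out (T := fun q => ent T q.1 q.2)).
Qed.

Lemma gtmx_addE a b i j :
  gtmx_entry (a + b) i j = gtmx_entry a i j + gtmx_entry b i j.
Proof. exact: gtmx_ofE. Qed.

Lemma gtmx_scaleE r a i j : gtmx_entry (r *: a) i j = r *: gtmx_entry a i j.
Proof. exact: gtmx_ofE. Qed.

Lemma gtmx_mulE a b i k :
  gtmx_entry (a * b) i k = \sum_j emul (gtmx_entry a i j) (gtmx_entry b j k).
Proof. exact: gtmx_ofE. Qed.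

Lemma gtmx_mul_deltaE a i j (m : ent T i j) k :
  gtmx_entry (a * gtmx_delta m) k j = emul (gtmx_entry a k i) m.
Proof.
rewrite gtmx_mulE (bigD1 i) //= gtmx_deltaE big1 ?addr0 // => s si.
by rewrite gtmx_delta_off ?emul0r // xpair_eqE eq_sym (negPf si).
Qed.

Lemma gtmx_mul_delta_off a i j (m : ent T i j) k l :
  j != l -> gtmx_entry (a * gtmx_delta m) k l = 0.
Proof.
move=> jl; rewrite gtmx_mulE big1 // => s _.
by rewrite gtmx_delta_off ?emul0r // xpair_eqE (negPf jl) andbF.
Qed.

Lemma gtmx_delta_mul i j k (x : ent T i j) (y : ent T j k) :
  gtmx_delta x * gtmx_delta y = gtmx_delta (emul x y).
Proof.
apply: gtmxP => s t; have [<-{t}|kt] := eqVneq k t; last first.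
  by rewrite gtmx_mul_delta_off ?gtmx_delta_off // xpair_eqE (negPf kt) andbF.
rewrite gtmx_mul_deltaE; have [<-{s}|is_] := eqVneq i s; first by rewrite !gtmx_deltaE.
by rewrite !gtmx_delta_off ?emul0l // xpair_eqE (negPf is_).
Qed.

Lemma gtmx_delta_mul0 i j k l (x : ent T i j) (y : ent T k l) :
  j != k -> gtmx_delta x * gtmx_delta y = 0.
Proof.
move=> jk; apply: gtmxP => s t; rewrite [RHS]gtmx_ofE.
have [<-{t}|lt] := eqVneq l t; last by rewrite gtmx_mul_delta_off.
by rewrite gtmx_mul_deltaE gtmx_delta_off ?emul0l // xpair_eqE (negPf jk) andbF.
Qed.

Lemma gtmx_delta_linear r i j (x y : ent T i j) :
  gtmx_delta (r *: x + y) = r *: gtmx_delta x + gtmx_delta y.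
Proof.
apply: gtmxP => s t; rewrite gtmx_addE gtmx_scaleE.
have [[<- <-]|neq] := eqVneq (i, j) (s, t); first by rewrite !gtmx_deltaE.
by rewrite !gtmx_delta_off // scaler0 addr0.
Qed.

Lemma gtmx_sum_delta a :
  a = \sum_(p : 'I_n * 'I_n) gtmx_delta (gtmx_entry a p.1 p.2).
Proof.
apply: gtmxP => s t.
rewrite (big_morph (fun b => gtmx_entry b s t) (id1 := 0) (op1 := +%R));
  [|by move=> b c; rewrite gtmx_addE|exact: gtmx_ofE].
rewrite (bigD1 (s, t)) //= gtmx_deltaE big1 ?addr0 // => -[k l] neq.
exact: gtmx_delta_off.
Qed.

Variable psi : {linear gtmx T -> gtmx T}.
Hypothesis psi_loc : forall a, exists x, psi a = x * a.

Let e i : gtmx T := gtmx_delta (eone T i).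

Let e_idem i : e i * e i = e i.
Proof. by rewrite gtmx_delta_mul emul1l. Qed.

Let local_e i : psi (e i) = psi 1 * e i.
Proof. exact: local_mul_idempotent. Qed.

(** [E_ij m] is the difference of the idempotents [E_ii 1 + E_ij m] and
    [E_ii 1]. *)
Lemma local_offdiag i j (m : ent T i j) :
  i != j -> psi (gtmx_delta m) = psi 1 * gtmx_delta m.
Proof.
move=> ij; have f_idem : (e i + gtmx_delta m) * (e i + gtmx_delta m)
    = e i + gtmx_delta m.
  rewrite mulrDl !mulrDr e_idem gtmx_delta_mul emul1l.
  by rewrite !(gtmx_delta_mul0 m) 1?eq_sym // !addr0.
have : psi (e i + gtmx_delta m) = psi 1 * (e i + gtmx_delta m).
  exact: local_mul_idempotent.
by rewrite linearD mulrDr local_e => /addrI.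
Qed.

(** Both sides live in column [i], whose entries below the diagonal vanish.  The
    [(k, i)] entry is a local left multiplier of [c], so it is determined by its
    value at the unit of [A_ii], where the idempotent [E_ii 1] gives the answer. *)
Lemma local_diag i (c : ent T i i) :
  (forall k, (k <= i)%N -> forall tau : {linear diag T i -> entry_rmod T k i},
     local_left_multiplier tau -> left_multiplier tau) ->
  psi (gtmx_delta c) = psi 1 * gtmx_delta c.
Proof.
move=> hT; apply: gtmxP => k l; have [<-{l}|il] := eqVneq i l; last first.
  by have [x ->] := psi_loc (gtmx_delta c); rewrite !gtmx_mul_delta_off.
have [ki|ik] := leqP k i; last by rewrite (ent_lower ik (gtmx_entry _ k i)) [RHS]ent_lower.
pose f (d : diag T i) : entry_rmod T k i := gtmx_entry (psi (gtmx_delta d)) k i.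
have fL : linear f.
  by move=> r x y; rewrite /f gtmx_delta_linear linearP gtmx_addE gtmx_scaleE.
pose tau : {linear diag T i -> entry_rmod T k i} :=
  HB.pack f (GRing.isLinear.Build R (diag T i) (entry_rmod T k i) _ f fL).
have /(hT k ki) tau_mul : local_left_multiplier tau.
  move=> d; have [x psi_d] := psi_loc (gtmx_delta d).
  by exists (gtmx_entry x k i); rewrite /tau /= /f psi_d gtmx_mul_deltaE.
have := tau_mul c; rewrite /tau /= /f => ->.
(* The unit of the algebra [diag T i] is [eone T i]. *)
rewrite -[X in gtmx_delta X]/(eone T i) local_e.
by rewrite !gtmx_mul_deltaE emul1r.
Qed.

End MatrixUnits.

Theorem theorem4p1 (R : comPzRingType) (n : nat) (T : tri_system R n)
  (A : unital_algebra R) (hA : alg_isomorphic A (gtmx T))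
  (hT : forall i k : 'I_n, (k <= i)%N ->
     forall psi : {linear diag T i -> entry_rmod T k i},
       local_left_multiplier psi -> left_multiplier psi) :
  SLIP A.
Proof.
apply: SLIP_iso hA _ => psi /LIP_local psi_loc a.
(* The action of the regular right module is the product. *)
change (psi a = psi 1 * a).
rewrite [in LHS](gtmx_sum_delta a) [in RHS](gtmx_sum_delta a) linear_sum mulr_sumr.
apply: eq_bigr => -[i j] _ /=; have [ij|ij] := eqVneq i j; last exact: local_offdiag.
by case: _ / ij (gtmx_entry _ _ _) => c; apply: local_diag => // k; apply: hT.
Qed.
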